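(* The $K$-linear dimension of the center $Z(L\wr G)$, i.e. $\sum_{l\in[1,k]}\dim_KZ(K_l)$, equals the number of conjugacy classes of $N$.
   Context: A finite group $G$ acts (from the right, $y\mapsto y^\sigma$, by field automorphisms, not necessarily faithfully) on a field $L$ with fixed field $K$. Let $N$ be the kernel of this operation, and assume that $n=|N|$ is invertible in $K$. The twisted group ring $L\wr G$ is the $K$-algebra which as a right $L$-vector space has basis $G$, with multiplication determined by $(\sigma y)(\tau z)=(\sigma\tau)(y^\tau z)$ for $\sigma,\tau\in G$, $y,z\in L$. It is semisimple. $X_1,\dots,X_k$ are representatives of the isomorphism classes of simple right $L\wr G$-modules, and $K_l=\operatorname{End}_{L\wr G}X_l$ is the endomorphism skew field. Conjugacy classes of $N$ are those of $N$ under conjugation by $N$. *)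

(* Defs.v *)
From HB Require Import structures.
From mathcomp Require Import all_boot all_order all_algebra all_fingroup.
From mathcomp Require Import boolp.

Set Implicit Arguments.
Unset Strict Implicit.
Unset Printing Implicit Defensive.

Import GRing.Theory.
Local Open Scope ring_scope.

(* A right action y ^ s := to y s of the finite group gT on L by field
   endomorphisms, which are then automorphisms as gT is a group. *)
Record fieldAction (gT : finGroupType) (L : fieldType) := FieldAction {
  fact :> {action gT &-> L};
  fact_zmod : forall s, zmod_morphism (fact^~ s);
  fact_monoid : forall s, monoid_morphism (fact^~ s) }.

Section FixedField.
Variables (gT : finGroupType) (L : fieldType) (to : fieldAction gT L).

Definition fact_aut (s : gT) (y : L) : L := to y s.

HB.instance Definition _ (s : gT) :=
  GRing.isZmodMorphism.Build L L (fact_aut s) (fact_zmod to s).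
HB.instance Definition _ (s : gT) :=
  GRing.isMonoidMorphism.Build L L (fact_aut s) (fact_monoid to s).

Lemma fact0 s : to 0 s = 0. Proof. exact: (rmorph0 (fact_aut s)). Qed.
Lemma fact1 s : to 1 s = 1. Proof. exact: (rmorph1 (fact_aut s)). Qed.
Lemma factD s : {morph to^~ s : x y / x + y}.
Proof. exact: (rmorphD (fact_aut s)). Qed.
Lemma factB s : {morph to^~ s : x y / x - y}.
Proof. exact: (rmorphB (fact_aut s)). Qed.
Lemma factM s : {morph to^~ s : x y / x * y}.
Proof. exact: (rmorphM (fact_aut s)). Qed.
Lemma factV s : {morph to^~ s : x / x^-1}.
Proof. exact: (fmorphV (fact_aut s)). Qed.
Lemma fact_sum s I (r : seq I) (P : pred I) (F : I -> L) :
  to (\sum_(i <- r | P i) F i) s = \sum_(i <- r | P i) to (F i) s.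
Proof. exact: (rmorph_sum (fact_aut s)). Qed.
Lemma fact_mulg y s t : to y (s * t)%g = to (to y s) t.
Proof. by case: (fact to) => f [fI fM]; apply: fM; rewrite inE. Qed.
Lemma fact_id y : to y 1%g = y.
Proof.
have [f_inj _] : is_action setT to by case: (fact to).
by apply: (f_inj 1%g); rewrite -fact_mulg mulg1.
Qed.

Definition fixed : {pred L} := [pred y | [forall s, to y s == y]].

Lemma fixedP y : reflect (forall s, to y s = y) (y \in fixed).
Proof. exact: 'forall_eqP. Qed.

Fact fixed_divring_closed : divring_closed fixed.
Proof.
split=> [|x y /fixedP fx /fixedP fy|x y /fixedP fx /fixedP fy];
  apply/fixedP=> s.
- exact: fact1.
- by rewrite factB fx fy.
- by rewrite factM factV fx fy.
Qed.
HB.instance Definition _ :=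
  GRing.isDivringClosed.Build L fixed fixed_divring_closed.

Record fixedField : Type := FixedField {
  fixed_val : L; fixed_valP : fixed_val \in fixed }.

HB.instance Definition _ := [isSub for fixed_val].
HB.instance Definition _ := [Choice of fixedField by <:].
HB.instance Definition _ := [SubChoice_isSubComUnitRing of fixedField by <:].
HB.instance Definition _ :=
  [SubComUnitRing_isSubIntegralDomain of fixedField by <:].
HB.instance Definition _ := [SubIntegralDomain_isSubField of fixedField by <:].

Lemma fact_fixed (c : fixedField) s : to (val c) s = val c.
Proof. exact: (fixedP _ (valP c)). Qed.

Definition fact_ker : {set gT} := [set s | `[< forall y, to y s = y >]].

Lemma fact_kerP s : reflect (forall y, to y s = y) (s \in fact_ker).
Proof. by rewrite inE; apply: asboolP. Qed.

Fact fact_ker_group_set : group_set fact_ker.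
Proof.
apply/group_setP; split=> [|s t /fact_kerP Ns /fact_kerP Nt].
  by apply/fact_kerP=> y; rewrite fact_id.
by apply/fact_kerP=> y; rewrite fact_mulg Ns Nt.
Qed.
Canonical fact_ker_group := Group fact_ker_group_set.

End FixedField.

Arguments fixed {gT L} to.
Arguments fixedField {gT L} to.
Arguments fact_ker {gT L} to.

(* f : twisted to represents \sum_s s (f s); the multiplication is the
   biadditive extension of (s y) (t z) = (s t) (y ^ t z), see tw_mul. *)
Definition twisted (gT : finGroupType) (L : fieldType)
  (to : fieldAction gT L) : Type := {ffun gT -> L}.

HB.instance Definition _ gT L (to : fieldAction gT L) :=
  GRing.Zmodule.copy (twisted to) {ffun gT -> L}.

Section TwistedGroupRing.
Variables (gT : finGroupType) (L : fieldType) (to : fieldAction gT L).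
Local Notation K := (fixedField to).
Local Notation A := (twisted to).
Implicit Types f g h : A.

Definition tw (s : gT) (y : L) : A := [ffun t => if t == s then y else 0].
Definition tw_one : A := tw 1%g 1.
Definition tw_mulf f g : A :=
  [ffun r => \sum_t to (f (r * t^-1)%g) t * g t].

Fact tw_mulA : associative tw_mulf.
Proof.
move=> f g h; apply/ffunP=> r; rewrite !ffunE.
under [RHS]eq_bigr do rewrite ffunE fact_sum mulr_suml.
rewrite [RHS]exchange_big /=.
under eq_bigr do rewrite ffunE mulr_sumr.
rewrite exchange_big /= [RHS]exchange_big /=; apply: eq_bigr => u _.
rewrite [RHS](reindex_inj (mulIg u^-1%g)) /=; apply: eq_bigr => t _.
rewrite factM -fact_mulg mulgKV invMg invgK -!mulgA.
by rewrite mulKg mulrA.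
Qed.

Fact tw_mul1 : left_id tw_one tw_mulf.
Proof.
move=> f; apply/ffunP=> r; rewrite ffunE (bigD1 r) //= big1 ?addr0.
  by rewrite ffunE mulgV eqxx fact1 mul1r.
move=> t /negPf ne; rewrite ffunE.
by rewrite -(inj_eq (mulIg t)) mulgKV mul1g eq_sym ne fact0 mul0r.
Qed.

Fact tw_mulr1 : right_id tw_one tw_mulf.
Proof.
move=> f; apply/ffunP=> r; rewrite ffunE (bigD1 1%g) //= big1 ?addr0.
  by rewrite ffunE eqxx mulr1 invg1 mulg1 fact_id.
by move=> t /negPf ne; rewrite ffunE ne mulr0.
Qed.

Fact tw_mulDl : left_distributive tw_mulf +%R.
Proof.
move=> f g h; apply/ffunP=> r; rewrite !ffunE -big_split /=.
by apply: eq_bigr => t _; rewrite ffunE factD mulrDl.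
Qed.

Fact tw_mulDr : right_distributive tw_mulf +%R.
Proof.
move=> f g h; apply/ffunP=> r; rewrite !ffunE -big_split /=.
by apply: eq_bigr => t _; rewrite ffunE mulrDr.
Qed.

Fact tw_one_neq0 : tw_one != 0.
Proof.
by apply/eqP=> /ffunP/(_ 1%g); rewrite !ffunE eqxx; apply/eqP/oner_neq0.
Qed.

HB.instance Definition _ := GRing.Zmodule_isNzRing.Build A
  tw_mulA tw_mul1 tw_mulr1 tw_mulDl tw_mulDr tw_one_neq0.

Definition tw_scale (c : K) f : A := [ffun s => val c * f s].

Fact tw_scaleA a b f : tw_scale a (tw_scale b f) = tw_scale (a * b) f.
Proof. by apply/ffunP=> s; rewrite !ffunE mulrA. Qed.
Fact tw_scale1 : left_id 1 tw_scale.
Proof. by move=> f; apply/ffunP=> s; rewrite !ffunE mul1r. Qed.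
Fact tw_scaleDr : right_distributive tw_scale +%R.
Proof. by move=> c f g; apply/ffunP=> s; rewrite !ffunE mulrDr. Qed.
Fact tw_scaleDl f : {morph tw_scale^~ f : a b / a + b}.
Proof. by move=> a b; apply/ffunP=> s; rewrite !ffunE mulrDl. Qed.

HB.instance Definition _ := GRing.Zmodule_isLmodule.Build K A
  tw_scaleA tw_scale1 tw_scaleDr tw_scaleDl.

Fact tw_scaleAl (c : K) f g : c *: (f * g) = (c *: f) * g.
Proof.
apply/ffunP=> r; rewrite !ffunE mulr_sumr; apply: eq_bigr => t _.
by rewrite ffunE factM fact_fixed mulrA.
Qed.
HB.instance Definition _ :=
  GRing.Lmodule_isLalgebra.Build K A tw_scaleAl.

Fact tw_scaleAr (c : K) f g : c *: (f * g) = f * (c *: g).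
Proof.
apply/ffunP=> r; rewrite !ffunE mulr_sumr; apply: eq_bigr => t _.
by rewrite ffunE mulrCA.
Qed.
HB.instance Definition _ :=
  GRing.Lalgebra_isAlgebra.Build K A tw_scaleAr.

Lemma tw_mul s t y z : tw s y * tw t z = tw (s * t)%g (to y t * z).
Proof.
apply/ffunP=> r; rewrite !ffunE (bigD1 t) //= big1 ?addr0.
  rewrite !ffunE eqxx -(inj_eq (mulIg t)) mulgKV.
  by case: eqP => // _; rewrite fact0 mul0r.
by move=> u /negPf ne; rewrite !ffunE ne mulr0.
Qed.

Lemma twE f : f = \sum_s tw s (f s).
Proof.
apply/ffunP=> r; rewrite sum_ffunE (bigD1 r) //= big1 ?addr0.
  by rewrite ffunE eqxx.
by move=> s /negPf ne; rewrite ffunE eq_sym ne.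
Qed.

End TwistedGroupRing.

Section Modules.
Variable R : pzRingType.

(* {pred X} ranges over all subsets of X, by classical logic (boolp). *)
Definition simple_module (X : lmodType R) : Prop :=
  (exists x : X, x != 0) /\
  forall S : {pred X}, submod_closed S -> S =i pred1 0 \/ S =i predT.

Definition isomorphic_modules (X Y : lmodType R) : Prop :=
  exists f : {linear X -> Y}, bijective f.

Definition simple_representatives (k : nat) (X : 'I_k -> lmodType R) : Prop :=
  [/\ forall l, simple_module (X l),
      forall l m, isomorphic_modules (X l) (X m) -> l = m &
      forall S : lmodType R, simple_module S ->
        exists l, isomorphic_modules S (X l)].

End Modules.

(* Right modules over A are left modules over the converse ring A^c, with
   x a := a *: x. For simple X, endo X is a skew field by Schur's lemma; c : F
   acts on it by (c *: f) x = (f x) c. *)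
Section Endomorphisms.
Variables (F : fieldType) (A : algType F) (X : lmodType A^c).

Definition endo : Type := {linear X -> X}.

HB.instance Definition _ := gen_eqMixin endo.
HB.instance Definition _ := gen_choiceMixin endo.

Implicit Types f g h : endo.

Lemma endoP f g : (f : {linear X -> X}) =1 (g : {linear X -> X}) -> f = g.
Proof.
case: f g => [f [[f1] [f2]]] [g [[g1] [g2]]] /= /funext fg.
subst g; congr GRing.Linear.Pack.
by rewrite (Prop_irrelevance f1 g1) (Prop_irrelevance f2 g2).
Qed.

Definition endo_zero : endo := \0.
Definition endo_opp f : endo := \- f.
Definition endo_add f g : endo := f \+ g.
Definition endo_one : endo := idfun.
Definition endo_mul f g : endo := f \o g.

Fact endo_addA : associative endo_add.
Proof. by move=> f g h; apply: endoP => x; apply: addrA. Qed.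
Fact endo_addC : commutative endo_add.
Proof. by move=> f g; apply: endoP => x; apply: addrC. Qed.
Fact endo_add0 : left_id endo_zero endo_add.
Proof. by move=> f; apply: endoP => x; apply: add0r. Qed.
Fact endo_addN : left_inverse endo_zero endo_opp endo_add.
Proof. by move=> f; apply: endoP => x; apply: addNr. Qed.
Fact endo_mulA : associative endo_mul.
Proof. by move=> f g h; apply: endoP. Qed.
Fact endo_mul1 : left_id endo_one endo_mul.
Proof. by move=> f; apply: endoP. Qed.
Fact endo_mulr1 : right_id endo_one endo_mul.
Proof. by move=> f; apply: endoP. Qed.
Fact endo_mulDl : left_distributive endo_mul endo_add.
Proof. by move=> f g h; apply: endoP. Qed.
Fact endo_mulDr : right_distributive endo_mul endo_add.
Proof. by move=> f g h; apply: endoP => x; apply: raddfD. Qed.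

HB.instance Definition _ := GRing.isPzRing.Build endo
  endo_addA endo_addC endo_add0 endo_addN
  endo_mulA endo_mul1 endo_mulr1 endo_mulDl endo_mulDr.

Definition endo_scalef (c : F) f (x : X) : X :=
  (c%:A : A^c) *: (f : {linear X -> X}) x.

Fact endo_scale_linear c f : linear (endo_scalef c f).
Proof.
move=> a x y; rewrite /endo_scalef linearP scalerDr !scalerA; congr (_ *: _ + _).
by rewrite -[LHS]/((a : A) * c%:A) -[RHS]/(c%:A * (a : A)) mulr_algl mulr_algr.
Qed.
HB.instance Definition _ c f :=
  GRing.isLinear.Build A^c X X *:%R (endo_scalef c f) (endo_scale_linear c f).
Definition endo_scale c f : endo := endo_scalef c f.

Fact endo_scaleA a b f : endo_scale a (endo_scale b f) = endo_scale (a * b) f.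
Proof.
apply: endoP => x /=; rewrite /endo_scalef scalerA; congr (_ *: _).
by rewrite -[LHS]/(b%:A * a%:A :> A) mulr_algl scalerA mulrC.
Qed.
Fact endo_scale1 : left_id 1 endo_scale.
Proof. by move=> f; apply: endoP => x /=; rewrite /endo_scalef !scale1r. Qed.
Fact endo_scaleDr : right_distributive endo_scale +%R.
Proof. by move=> c f g; apply: endoP => x; apply: scalerDr. Qed.
Fact endo_scaleDl f : {morph endo_scale^~ f : a b / a + b}.
Proof.
by move=> a b; apply: endoP => x /=; rewrite /endo_scalef scalerDl scalerDl.
Qed.

HB.instance Definition _ := GRing.Zmodule_isLmodule.Build F endo
  endo_scaleA endo_scale1 endo_scaleDr endo_scaleDl.

End Endomorphisms.

Definition center (R : pzRingType) (z : R) : Prop :=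
  forall x, GRing.comm z x.
Arguments center : clear implicits.

(* For a subspace S: S has finite dimension d over F. *)
Section Dimension.
Variables (F : fieldType) (V : lmodType F) (S : V -> Prop).

Definition is_basis (d : nat) (b : 'I_d -> V) : Prop :=
  [/\ forall i, S (b i),
      forall c : 'I_d -> F, \sum_i c i *: b i = 0 -> forall i, c i = 0 &
      forall v, S v -> exists c : 'I_d -> F, v = \sum_i c i *: b i].

Definition has_dim (d : nat) : Prop := exists b : 'I_d -> V, is_basis b.

End Dimension.

Arguments has_dim F {V} S d.

(* Main.v *)
Require Import Defs.
From HB Require Import structures.
From mathcomp Require Import all_boot all_order all_algebra all_fingroup.
From mathcomp Require Import boolp.

(* Write A for the twisted group ring. The extension L / K has Galois
   coordinates: finitely many (x, y) with \sum x y ^ s = 1 for s in N and 0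
   otherwise. As |N| is invertible they yield an element of trace 1, hence a
   Maschke projection onto every right ideal, and A is a sum of simple right
   ideals. A family of central endomorphisms of the simple modules is then
   realized by a unique central element of A, so Z(A) is the product of the
   Z(K_l). On the other hand Z(A) consists of the G-equivariant functions
   N -> L; averaging the class indicators against the Galois coordinates shows
   that Z(A) spans the L-space of class functions on N, and an L-basis of this
   space taken in Z(A) is a K-basis of Z(A). *)

Set Implicit Arguments.
Unset Strict Implicit.
Unset Printing Implicit Defensive.

Import GRing.Theory.
Local Open Scope ring_scope.

(** * Submodules and socles *)

Lemma submod_closed_vspace (F : fieldType) (V : vectType F) (S : {pred V}) :
  submod_closed S -> exists U : {vspace V}, S =i U.
Proof.
move=> [S0 Slin]; pose sub (U : {vspace V}) := forall x, x \in U -> x \in S.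
pose Q d := `[< exists2 U, sub U & \dim U = d >].
have exQ : exists d, Q d.
  by exists 0; apply/asboolP; exists 0%VS; [move=> x; rewrite memv0 => /eqP->|
    exact: dimv0].
have ubQ d : Q d -> (d <= \dim {:V})%N.
  by case/asboolP=> U _ <-; apply/dimvS/subvf.
(* [U] has maximal dimension among the subspaces inside [S]; adding a line of [S] stays inside [S],
   so it changes nothing. *)
case: (ex_maxnP exQ ubQ) => _ /asboolP[U subU <-] maxU; exists U => x.
apply/idP/idP=> [Sx|]; last exact: subU.
suff /eqP-> : (U == U + <[x]>)%VS by apply/(subvP (addvSr _ _))/memv_line.
rewrite eqEdim addvSl; apply/maxU/asboolP; exists (U + <[x]>)%VS => // y.
by case/memv_addP=> u /subU Su [_ /vlineP[c ->] ->]; rewrite addrC; apply: Slin.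
Qed.

Section Submodule.
Variables (R : pzRingType) (V : lmodType R) (S : {pred V}).

(* An alias indexed by the closedness proof, on which instances can be keyed. *)
Definition submod_pred of submod_closed S : {pred V} := S.

Variable hS : submod_closed S.
Local Notation T := (submod_pred hS).

HB.instance Definition _ := GRing.isSubmodClosed.Build R V T hS.

Record submodule : Type := Submodule {
  submod_val : V; submod_valP : submod_val \in T }.

HB.instance Definition _ := [isSub for submod_val].
HB.instance Definition _ := [Choice of submodule by <:].
HB.instance Definition _ := [SubChoice_isSubLmodule of submodule by <:].

Lemma submod_val_linear : linear submod_val.
Proof. by []. Qed.
HB.instance Definition _ :=
  GRing.isLinear.Build R submodule V *:%R submod_val submod_val_linear.

End Submodule.

(** Simple submodules enter only through maps from abstract simple modules, which can then be
    exchanged for the representatives [X l]. *)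
Inductive socle (R : pzRingType) (M : lmodType R) : M -> Prop :=
| socle0 : socle 0
| socleD (X : lmodType R) (f : {linear X -> M}) x y :
    simple_module X -> socle y -> socle (f x + y).

Lemma socle_add (R : pzRingType) (M : lmodType R) (x y : M) :
  socle x -> socle y -> socle (x + y).
Proof.
move=> + sy; elim=> [|X f u v simX _ IH]; first by rewrite add0r.
by rewrite -addrA; apply: socleD.
Qed.

(** The inclusion of [S], made a module of its own, is a map from a simple module with [x] in its
    image. *)
Lemma socle_submodule (R : pzRingType) (M : lmodType R) (S : {pred M})
    (x : M) :
  submod_closed S -> x \in S -> x != 0 ->
  (forall T : {pred M}, submod_closed T -> {subset T <= S} ->
    T =i pred1 0 \/ T =i S) ->
  socle x.
Proof.
move=> hS Sx x0 simS; rewrite -[x]addr0.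
pose X : lmodType R := submodule hS.
pose u : X := Submodule (Sx : x \in submod_pred hS).
apply: (@socleD _ _ X (@submod_val _ _ _ hS) u _ _ (socle0 _)).
split; first by exists u; rewrite -(inj_eq val_inj).
move=> T hT.
pose T' : {pred M} :=
  [pred y | `[< exists2 v : X, v \in T & val v = y >]].
have T'E (v : X) : (val v \in T') = (v \in T).
  apply/asboolP/idP => [[w Tw /val_inj <-] //|Tv]; by exists v.
have T'closed : submod_closed T'.
  split; first by apply/asboolP; exists 0; [case: hT|].
  move=> a _ _ /asboolP[v Tv <-] /asboolP[w Tw <-]; apply/asboolP.
  by exists (a *: v + w) => //; apply: hT.2.
case: (simS T' T'closed) => [_ /asboolP[v _ <-]|T'0|T'S].
- exact: valP.
- by left=> v; rewrite -T'E T'0 !inE -(inj_eq val_inj).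
- by right=> v; rewrite -T'E T'S !inE; apply: (valP v).
Qed.

(** * Schur's lemma and the action of central elements *)

Section Schur.
Variables (R : pzRingType) (X Y : lmodType R).
Hypotheses (simX : simple_module X) (simY : simple_module Y).

Lemma simple_hom (f : {linear X -> Y}) :
  f =1 (fun=> 0) \/ isomorphic_modules X Y.
Proof.
have [_ simX'] := simX; have [_ simY'] := simY.
have kerf : submod_closed [pred x | f x == 0].
  split; first by rewrite inE raddf0.
  by move=> a x y; rewrite !inE linearP => /eqP-> /eqP->; rewrite scaler0 addr0.
case: (simX' _ kerf) => [ker0|kerT]; last first.
  by left=> x; apply/eqP; have := kerT x; rewrite !inE.
have imf : submod_closed [pred y | `[< exists x, f x = y >]].
  split; first by apply/asboolP; exists 0; rewrite raddf0.
  move=> a _ _ /asboolP[x <-] /asboolP[y <-]; apply/asboolP.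
  by exists (a *: x + y); rewrite linearP.
case: (simY' _ imf) => [im0|imT].
  left=> x; apply/eqP; have := im0 (f x); rewrite !inE => <-.
  by apply/asboolP; exists x.
have f_inj : injective f.
  move=> x y fxy; apply/eqP; rewrite -subr_eq0.
  by have := ker0 (x - y); rewrite !inE raddfB /= fxy subrr eqxx => <-.
have surj y : exists x, f x == y.
  by have := imT y; rewrite !inE => /asboolP[x <-]; exists x.
right; exists f; exists (fun y => xchoose (surj y)) => [x|y].
  exact/f_inj/eqP/(xchooseP (surj (f x))).
exact/eqP/(xchooseP (surj y)).
Qed.

End Schur.

Section CentralAction.
Variables (F : fieldType) (A : algType F) (X : lmodType A^c).
Variables (z : A) (hz : center A z).

(** The proof of centrality is an argument so that the linear structure can be attached to this
    function. *)
Definition central_act_fun of center A z := fun x : X => (z : A^c) *: x.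

Fact central_act_linear : linear (central_act_fun hz).
Proof.
move=> a x y; rewrite /central_act_fun scalerDr !scalerA; congr (_ *: _ + _).
exact/esym/hz.
Qed.
HB.instance Definition _ := GRing.isLinear.Build A^c X X *:%R
  (central_act_fun hz) central_act_linear.

Definition central_act : endo X := central_act_fun hz.

Lemma central_act_center : center (endo X) central_act.
Proof. by move=> g; apply: endoP => x; rewrite /= /central_act_fun linearZ. Qed.

End CentralAction.

(** * Central elements of a semisimple algebra *)

Section CenterOfSemisimple.
Variables (F : fieldType) (A : algType F) (k : nat) (X : 'I_k -> lmodType A^c).
Hypotheses (hX : simple_representatives X) (hA : socle (1 : (A^c)^o)).

(** As [1] is a sum of elements [f u] with [u] in a simple module, [a] is the sum of the [f (u a)],
    and each [u a] vanishes by transport to some [X l]. *)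
Lemma semisimple_faithful (a : A) :
  (forall l (x : X l), (a : A^c) *: x = 0) -> a = 0.
Proof.
move=> aX; have [_ _ repX] := hX.
rewrite -[a](mulr1 (a : A^c)) -[_ * _]/((a : A^c) *: (1 : (A^c)^o)).
elim: hA => [|Y f u v simY _ IH]; first by rewrite scaler0.
have [l [g [h gK hK]]] := repX Y simY.
rewrite scalerDr IH addr0 -linearZ /=.
suff -> : (a : A^c) *: u = 0 by rewrite raddf0.
by rewrite -[u]gK -[_ *: _]gK [g _]linearZ /= gK aX -[RHS]gK raddf0.
Qed.

Variable c : forall l, endo (X l).
Hypothesis hc : forall l, center (endo (X l)) (c l).

(** By Schur a nonzero [f] forces [l = m]; then [f] lies in [endo (X l)] and commutes with the
    central [c l]. *)
Lemma central_endo_commute l m (f : {linear X l -> X m}) x :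
  f (c l x) = c m (f x).
Proof.
have [simX isoX _] := hX; have [e|ne] := eqVneq l m; last first.
  have [f0|/isoX e] := simple_hom (simX l) (simX m) f; last first.
    by rewrite e eqxx in ne.
  by rewrite !f0 raddf0.
subst m; have /(congr1 (fun h : endo (X l) => (h : {linear X l -> X l}) x)) :=
  hc (f : endo (X l)).
by move=> /= ->.
Qed.

(* If 1 = \sum f_i x_i with f_i : X_(l_i) -> A, take z = \sum f_i (c x_i): for x
   in X_m, y |-> x f_i(y) is a homomorphism X_(l_i) -> X_m, so it commutes with
   c and x z = c (x 1). *)
Lemma semisimple_realize :
  exists2 z, center A z & forall l (x : X l), (z : A^c) *: x = c l x.
Proof.
have [_ _ repX] := hX.
(* The factor [1] is kept visible because the induction on [hA] generalizes it to any socle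
   element. *)
have [z zP] : exists z : A, forall l (x : X l),
    (z : A^c) *: x = c l (((1 : (A^c)^o) : A^c) *: x).
  elim: hA => [|Y f u v simY _ [z IH]].
    by exists 0 => l x; rewrite !scale0r raddf0.
  have [m [g [h gK hK]]] := repX Y simY.
  exists ((f (h (c m (g u))) : A) + z) => l x.
  rewrite !scalerDl raddfD IH; congr (_ + _).
  pose phi (w : X m) : X l := (f (h w) : A^c) *: x.
  have philin : linear phi.
    move=> a w1 w2; rewrite /phi (can2_linear gK hK) linearP scalerDl.
    by rewrite scalerA.
  pose phiL := GRing.isLinear.Build A^c (X m) (X l) *:%R phi philin.
  pose Phi : {linear X m -> X l} := HB.pack phi phiL.
  have /= := central_endo_commute Phi (g u).
  by rewrite /phi gK.
have zE l (x : X l) : (z : A^c) *: x = c l x by rewrite zP scale1r.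
(* As [c l] is [A^c]-linear, [z * a] and [a * z] act alike on every [X l]. *)
exists z => // a; apply/eqP; rewrite -subr_eq0; apply/eqP.
apply: semisimple_faithful => l x.
rewrite scalerBl -[(z * a : A)]/((a : A^c) * (z : A^c)).
rewrite -[(a * z : A)]/((z : A^c) * (a : A^c)) -!scalerA !zE.
by rewrite linearZ subrr.
Qed.

End CenterOfSemisimple.

(** * Decomposition of the center of a semisimple algebra *)

Section Dimensions.
Variables (F : fieldType) (A : algType F) (k : nat) (X : 'I_k -> lmodType A^c).
Hypotheses (hX : simple_representatives X) (hA : socle (1 : (A^c)^o)).

Lemma scale_alg_act l (a : F) (z : A) (x : X l) :
  (a *: z : A^c) *: x = (a%:A : A^c) *: ((z : A^c) *: x).
Proof.
rewrite scalerA; congr (_ *: _); rewrite -[RHS]/((z : A) * a%:A).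
by rewrite mulr_algr.
Qed.

Lemma has_dim_center_semisimple n : has_dim F (center A) n ->
  exists d : 'I_k -> nat,
    (forall l, has_dim F (center (endo (X l))) (d l)) /\ (\sum_l d l)%N = n.
Proof.
case=> b [bZ b_free b_span].
(* Row vectors serve as coordinates on the center, so that it can be treated by finite-dimensional
   subspaces. *)
pose zv (v : 'rV[F]_n) : A := \sum_i v 0 i *: b i.
have zvlin : linear zv.
  move=> a u v; rewrite /zv scaler_sumr -big_split; apply: eq_bigr => i _ /=.
  by rewrite !mxE scalerDl scalerA.
pose Zv : {linear 'rV[F]_n -> A} :=
  HB.pack zv (GRing.isLinear.Build F 'rV[F]_n A *:%R zv zvlin).
have zvZ v : center A (Zv v).
  move=> a; apply/commr_sym/commr_sum => i _.
  by rewrite /GRing.comm -scalerAl -scalerAr (bZ i a).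
have zv_inj v : Zv v = 0 -> v = 0.
  by move=> /b_free v0; apply/rowP=> i; rewrite v0 mxE.
have zv_surj z : center A z -> exists v, z = Zv v.
  move=> /b_span[a ->]; exists (\row_i a i).
  by apply: eq_bigr => i _; rewrite mxE.
(* The factor of the center belonging to [X l]: its elements annihilate all other simple modules. *)
pose W l : {pred 'rV[F]_n} :=
  [pred v | `[< forall m, m != l -> forall x : X m, (Zv v : A^c) *: x = 0 >]].
have Wclosed l : submod_closed (W l).
  split; first by apply/asboolP=> m _ x; rewrite raddf0 scale0r.
  move=> a u v /asboolP Wu /asboolP Wv; apply/asboolP=> m ml x.
  by rewrite linearP scalerDl scale_alg_act Wu // Wv // scaler0 addr0.
have [U WU] := choice (fun l => submod_closed_vspace (Wclosed l)).
have WP l v :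
    reflect (forall m, m != l -> forall x : X m, (Zv v : A^c) *: x = 0)
      (v \in U l).
  by rewrite -WU; apply: asboolP.
have comp l (f : endo (X l)) : center (endo (X l)) f ->
  exists2 v, v \in U l & forall x, (Zv v : A^c) *: x = f x.
  move=> fZ; have [c c_l c_ne] : exists2 c : forall m, endo (X m),
      c l = f & forall m, l != m -> c m = 0.
    exists (dfwith (fun m => 0 : endo (X m)) f); first exact: dfwith_in.
    exact: dfwith_out.
  have hc m : center (endo (X m)) (c m).
    have [<-|ne] := eqVneq l m; first by rewrite c_l.
    by rewrite c_ne // => g; rewrite /GRing.comm mul0r mulr0.
  have [_ /zv_surj[v ->] vE] := semisimple_realize hX hA hc.
  exists v => [|x]; last by rewrite vE c_l.
  by apply/WP => m ml x; rewrite vE c_ne // eq_sym.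
exists (fun l => \dim (U l)); split=> [l|].
  (* Acting on [X l] maps [U l] isomorphically onto the center of [endo (X l)]: onto by [comp],
     injectively because [U l] already kills the other simple modules. *)
  pose e (i : 'I_(\dim (U l))) := central_act (X l) (zvZ (vbasis (U l))`_i).
  have sumE (a : 'I_(\dim (U l)) -> F) x :
      (\sum_i a i *: e i : endo (X l)) x
      = (Zv (\sum_i a i *: (vbasis (U l))`_i) : A^c) *: x.
    rewrite (raddf_sum Zv) scaler_suml.
    elim/big_rec2: _ => //= i f y _ <-.
    by rewrite [zv _](linearZ_LR Zv) scale_alg_act.
  exists e; split=> [i|a ae0 i|f fZ]; first exact: central_act_center.
    have : \sum_i a i *: (vbasis (U l))`_i = 0.
      apply/zv_inj/(semisimple_faithful hX hA) => m x.
      have [e'|ml] := eqVneq m l; first by subst m; rewrite -sumE ae0.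
      have /WP : \sum_i a i *: (vbasis (U l))`_i \in U l.
        by apply: memv_suml => j _; apply/memvZ/vbasis_mem/mem_nth;
          rewrite size_tuple.
      by apply.
    by move=> a0; have /freeP/(_ a a0) := basis_free (vbasisP (U l)); apply.
  have [v Uv vE] := comp l f fZ.
  exists (fun i => coord (vbasis (U l)) i v); apply: endoP => x.
  by rewrite sumE -(coord_vbasis Uv) vE.
(* The action of [v] on each [X l] is realized within [U l]; the sum of these elements acts as [v]
   everywhere. *)
have sumU : (\sum_l U l = fullv)%VS.
  apply/vspaceP=> v; rewrite memvf.
  have [w wU wE] : exists2 w : 'I_k -> 'rV[F]_n, forall l, w l \in U l &
      forall l (x : X l), (Zv (w l) : A^c) *: x = (Zv v : A^c) *: x.
    have [w wP] := choice (fun l =>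
      (exists2P _ _).1 (comp l _ (@central_act_center _ _ (X l) _ (zvZ v)))).
    by exists w => l; case: (wP l).
  suff -> : v = \sum_l w l by apply: memv_sumr.
  apply/eqP; rewrite -subr_eq0; apply/eqP/zv_inj.
  apply: (semisimple_faithful hX hA) => m x.
  rewrite (raddfB Zv) (raddf_sum Zv) scalerBl [X in _ - X]scaler_suml.
  rewrite (bigD1 m) //= (wE m) big1 ?addr0 ?subrr //.
  by move=> l lm; move/WP: (wU l); apply; rewrite eq_sym.
(* On [X m] a sum of elements of the [U l] acts through its component at [m] alone. *)
have /directvP : directv (\sum_l U l).
  apply/directv_sum_independent => u uU u0 l _; apply/zv_inj.
  apply: (semisimple_faithful hX hA) => m x.
  have [->|ml] := eqVneq l m; last first.
    by move/WP: (uU l isT); apply; rewrite eq_sym.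
  have : (Zv (\sum_l u l) : A^c) *: x = 0 by rewrite u0 raddf0 scale0r.
  rewrite (raddf_sum Zv) scaler_suml (bigD1 m) //= big1 ?addr0 // => j jm.
  by move/WP: (uU j isT); apply; rewrite eq_sym.
by rewrite /= sumU => <-; rewrite dimvf dim_matrix; apply: mul1n.
Qed.

End Dimensions.

(** * Bases from spanning sets, Galois coordinates and trace *)

(** [S] is an arbitrary property: it will be centrality, which need not be stable under scaling by
    [L]. *)
Lemma free_subset_span (F : fieldType) (V : vectType F) (S : V -> Prop)
    (ys : seq V) : (forall y, y \in ys -> S y) ->
  exists bs : seq V,
    [/\ free bs, forall b, b \in bs -> S b & <<bs>>%VS = <<ys>>%VS].
Proof.
elim: ys => [|y ys IH] ysS.
  by exists [::]; split=> //; apply: nil_free.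
have [z zys|bs [bs_free bsS bsE]] := IH.
  by apply: ysS; rewrite inE zys orbT.
have [yin|ynotin] := boolP (y \in <<bs>>%VS).
  by exists bs; rewrite span_cons -bsE; split=> //; apply/esym/addv_idPr.
exists (y :: bs); split; first by rewrite free_cons ynotin.
  by move=> b; rewrite inE => /predU1P[->|/bsS//]; apply/ysS/mem_head.
by rewrite !span_cons bsE.
Qed.

Section GaloisCoordinates.
Variables (gT : finGroupType) (L : fieldType) (to : fieldAction gT L).
Local Notation N := (fact_ker to).

(** Zeros outside [N] are imposed one element at a time, starting from the pair [(1, 1)] and keeping
    the value 1 on [N]. *)
Lemma galois_coordinates : exists r : seq (L * L),
  forall s, \sum_(p <- r) p.1 * to p.2 s = (s \in N)%:R.
Proof.
suff /(_ (enum gT))[r rN r0] : forall ss : seq gT, exists2 r : seq (L * L),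
    forall s, s \in N -> \sum_(p <- r) p.1 * to p.2 s = 1 &
    forall s, s \in ss -> s \notin N -> \sum_(p <- r) p.1 * to p.2 s = 0.
  by exists r => s; have [/rN//|/r0->//] := boolP (s \in N); rewrite mem_enum.
elim=> [|t ss [r rN r0]].
  by exists [:: (1, 1)] => // s _; rewrite big_seq1 fact1 mulr1.
have [tN|tN] := boolP (t \in N).
  by exists r => // s; rewrite inE => /predU1P[->|/r0//]; rewrite tN.
have [u ut] : exists u, to u t != u.
  apply: contrapT => /forallNP tfix; case/negP: tN; apply/fact_kerP => u.
  by apply/eqP; move/negP: (tfix u); rewrite negbK.
(* Multiply the sum by s |-> a (u ^ s - u ^ t), which is 1 on N and 0 at t. *)
pose a := (u - to u t)^-1.
have a0 : u - to u t != 0 by rewrite subr_eq0 eq_sym.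
pose r' := [seq (a * p.1, u * p.2) | p <- r] ++
           [seq (- (a * to u t) * p.1, p.2) | p <- r].
have r'E s : \sum_(p <- r') p.1 * to p.2 s =
    a * (to u s - to u t) * \sum_(p <- r) p.1 * to p.2 s.
  rewrite big_cat !big_map /= mulr_sumr -big_split; apply: eq_bigr => p _ /=.
  rewrite factM mulrBr mulrBl !mulrA mulNr mulNr; congr (_ - _).
  by rewrite [_ * to u s]mulrAC.
exists r' => [s sN|s]; rewrite r'E.
  by rewrite rN // mulr1 (fact_kerP _ _ sN) mulVf.
rewrite inE => /predU1P[->|/r0 r0s /r0s->]; last by rewrite mulr0.
by rewrite subrr mulr0 mul0r.
Qed.

Hypothesis hn : (#|N|%:R : L) != 0.

(** If all traces vanished, summing the coordinate identity over [s] would give [#|N| = 0] in [L].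
    Traces are fixed, so a nonzero one can be divided out. *)
Lemma trace_one : exists y, \sum_s to y s = 1.
Proof.
have [r rE] := galois_coordinates.
have trfix y t : to (\sum_s to y s) t = \sum_s to y s.
  rewrite fact_sum [RHS](reindex_inj (mulIg t)); apply: eq_bigr => s _.
  by rewrite fact_mulg.
have [y y0] : exists y, \sum_s to y s != 0.
  apply: contrapT => /forallNP tr0; case/eqP: hn.
  have : \sum_s \sum_(p <- r) p.1 * to p.2 s = 0.
    rewrite exchange_big big1 // => p _; rewrite -mulr_sumr.
    by have /negP := tr0 p.2; rewrite negbK => /eqP->; rewrite mulr0.
  move=> <-; under eq_bigr do rewrite rE.
  by rewrite -natr_sum -big_mkcond sum1_card.
exists (y / \sum_s to y s).
under eq_bigr do rewrite factM factV trfix.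
by rewrite -mulr_suml divff.
Qed.

End GaloisCoordinates.

(** * The twisted group ring as a vector space over [L] *)

Section Twisted.
Variables (gT : finGroupType) (L : fieldType) (to : fieldAction gT L).
Local Notation N := (fact_ker to).
Local Notation K := (fixedField to).
Local Notation A := (twisted to).
Local Notation V := {ffun gT -> L^o}.

Lemma mul_twE (f : A) s y r : (f * tw to s y) r = to (f (r * s^-1)%g) s * y.
Proof.
rewrite ffunE (bigD1 s) //= ffunE eqxx big1 ?addr0 // => t /negPf ts.
by rewrite ffunE ts mulr0.
Qed.

Lemma tw_mulE (f : A) s y r :
  (tw to s y * f) r = to y (s^-1 * r)%g * f (s^-1 * r)%g.
Proof.
rewrite ffunE (bigD1 (s^-1 * r)%g) //= ffunE invMg invgK mulKVg eqxx.
rewrite big1 ?addr0 // => t ts; rewrite ffunE.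
case: eqP => [rts|_]; last by rewrite Defs.fact0 mul0r.
by rewrite -rts invMg invgK mulgKV eqxx in ts.
Qed.

(** Scaling in [V] is the right [L]-structure of the ring, so right ideals are [L]-subspaces and
    have a dimension. *)
Lemma scale_twisted (f : A) y : y *: (f : V) = f * tw to 1%g y.
Proof.
by apply/ffunP=> r; rewrite ffunE mul_twE invg1 mulg1 fact_id mulrC.
Qed.

Lemma tw_sum s I (r : seq I) (P : pred I) (F : I -> L) :
  tw to s (\sum_(i <- r | P i) F i) = \sum_(i <- r | P i) tw to s (F i).
Proof.
apply/ffunP=> t; rewrite sum_ffunE ffunE; case: eqP => [->|/eqP/negPf ts].
  by apply: eq_bigr => i _; rewrite ffunE eqxx.
by rewrite big1 // => i _; rewrite ffunE ts.
Qed.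

Lemma twisted_vspace (S : {pred (A^c)^o}) :
  submod_closed S -> exists U : {vspace V}, S =i U.
Proof.
case=> S0 Slin; apply: (@submod_closed_vspace L V S); split=> // a u v Su Sv.
by rewrite scale_twisted; apply: (Slin (tw to 1%g a)).
Qed.

(** * Maschke's theorem and semisimplicity *)

Section Maschke.
Variable y : L.
Hypothesis try : \sum_s to y s = 1.

(* The factor y compensates for |G|, which need not be invertible in L. *)
Definition average (p : A -> A) (a : A) : A :=
  \sum_s p (a * tw to s^-1%g 1) * tw to s (to y s).

Lemma averageM (p : {linear V -> V}) (a b : A) :
  average p (a * b) = average p a * b.
Proof.
have avD u v : average p (u + v) = average p u + average p v.
  rewrite /average -big_split; apply: eq_bigr => s _ /=.
  by rewrite mulrDl [p _]raddfD mulrDl.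
have av0 : average p 0 = 0.
  by rewrite /average big1 // => s _; rewrite mul0r [p 0]raddf0 mul0r.
have pZ (c : A) z : p (c * tw to 1%g z) = (p c : A) * tw to 1%g z.
  by rewrite -!scale_twisted linearZ.
(* By additivity take [b = tw h z] and put [s = g h]: up to a scalar [p] is applied to [a g^-1]; the
   scalar passes through [p], and [g h] turns it back into [z]. *)
rewrite [b]twE !mulr_sumr (big_morph _ avD av0); apply: eq_bigr => h _.
move: (b h) => z; rewrite /average mulr_suml [LHS](reindex_inj (mulIg h)) /=.
apply: eq_bigr => g _; rewrite -mulrA -[RHS]mulrA !tw_mul invMg mulKVg mulr1.
have -> w : tw to g^-1%g w = tw to g^-1%g 1 * tw to 1%g w.
  by rewrite tw_mul mulg1 fact1 mul1r.
rewrite mulrA pZ -mulrA tw_mul mul1g -!fact_mulg -invMg mulVg fact_id.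
by rewrite mulrC.
Qed.

(** Average an [L]-linear projection onto [S]. On [S] the summand at [s] is [x] times [y ^ s], and
    [y] has trace 1. *)
Lemma maschke (S : {pred (A^c)^o}) : submod_closed S ->
  exists P : {linear (A^c)^o -> (A^c)^o},
    (forall x, P x \in S) /\ (forall x, x \in S -> P x = x).
Proof.
move=> hS; have [U SU] := twisted_vspace hS; have [S0 Slin] := hS.
have SM (x a : A) : x \in S -> x * a \in S.
  by move=> Sx; rewrite -[x * a]addr0; apply: (Slin a).
pose P : (A^c)^o -> (A^c)^o := average (projv U).
have Plin : linear P.
  move=> a u v.
  have PD (u' v' : (A^c)^o) : P (u' + v') = P u' + P v'.
    rewrite /P /average -big_split; apply: eq_bigr => s _ /=.
    by rewrite (mulrDl (u' : A)) [projv U _]raddfD (mulrDl (_ : A)).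
  by rewrite PD; congr (_ + _); apply: (averageM (projv U) (u : A) (a : A)).
pose PL : {linear (A^c)^o -> (A^c)^o} :=
  HB.pack P (GRing.isLinear.Build A^c (A^c)^o (A^c)^o *:%R P Plin).
exists PL; split=> x /=; rewrite /P /average.
  have [+ _] : subsemimod_closed S by apply: GRing.submod_closed_semi.
  case=> _ SD.
  by elim/big_ind: _ => // s _; apply: SM; rewrite SU; apply: memv_proj.
move=> Sx.
transitivity ((x : A) * tw to 1%g (\sum_s to y s)); last by rewrite try mulr1.
rewrite tw_sum mulr_sumr; apply: eq_bigr => s _.
rewrite projv_id; last by rewrite -SU; apply: SM.
by rewrite -mulrA tw_mul mulVg fact1 mul1r.
Qed.

(** Induction on the dimension over [L]. If [S] has a proper nonzero submodule [T], a projection [P]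
    onto [T] splits [x] into [P x] in [T] and [x - P x] in the kernel of [P] on [S], both of smaller
    dimension. *)
Lemma submodule_socle (S : {pred (A^c)^o}) (x : (A^c)^o) :
  submod_closed S -> x \in S -> socle x.
Proof.
move=> hS; have [U] := twisted_vspace hS.
have [d] := ubnP (\dim U); elim: d S x U hS => // d IH S x U hS ltUd SU Sx.
have [->|x0] := eqVneq x 0; first exact: socle0.
have [simS|] := pselect (forall T : {pred (A^c)^o}, submod_closed T ->
  {subset T <= S} -> T =i pred1 0 \/ T =i S).
  exact: (socle_submodule hS Sx x0 simS).
move=> /existsNP[T /not_implyP[hT /not_implyP[TS /not_orP[T0 nTS]]]].
have [P [PT Pid]] := maschke hT.
have smaller (T' : {pred (A^c)^o}) z z' :
    submod_closed T' -> {subset T' <= S} ->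
    z \in S -> z \notin T' -> z' \in T' -> socle z'.
  move=> hT' T'S Sz T'z T'z'; have [U' TU'] := twisted_vspace hT'.
  apply: (IH T' z' U') => //.
  rewrite -ltnS; apply: leq_trans ltUd; rewrite ltnS.
  have sub : (U' <= U)%VS by apply/subvP => w; rewrite -TU' -SU; apply: T'S.
  rewrite (ltn_leqif (dimv_leqif_sup sub)); apply/subvPn; exists z.
    by rewrite -SU.
  by rewrite -TU'.
have [z Sz Tz] : exists2 z, z \in S & z \notin T.
  apply: contrapT => noz; apply: nTS => z; apply/idP/idP => [/TS//|Sz].
  by apply: contrapT => /negP Tz; apply: noz; exists z.
have [t Tt t0] : exists2 t, t \in T & t != 0.
  apply: contrapT => not0; apply: T0 => t; rewrite inE.
  apply/idP/eqP => [Tt|->]; last by case: hT.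
  by apply: contrapT => /eqP t0; apply: not0; exists t.
have [S0 Slin] := hS.
pose T' : {pred (A^c)^o} := [pred w | (w \in S) && (P w == 0)].
have hT' : submod_closed T'.
  split; first by rewrite inE S0 raddf0 eqxx.
  move=> a u v; rewrite !inE => /andP[Su /eqP Pu] /andP[Sv /eqP Pv].
  by rewrite Slin // linearP Pu Pv scaler0 addr0 eqxx.
rewrite -[x](subrK (P x)); apply: socle_add.
  apply: (smaller T' t) => //.
  - by move=> w; rewrite inE => /andP[].
  - exact: TS.
  - by rewrite inE Pid // (negPf t0) andbF.
  rewrite inE raddfB /= (Pid (P x)) // subrr eqxx andbT addrC -scaleN1r.
  by apply: Slin => //; apply: TS.
exact: (smaller T z).
Qed.

End Maschke.

Lemma twisted_socle : (#|N|%:R : L) != 0 -> socle (1 : (A^c)^o).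
Proof.
case/trace_one=> y try; apply: (submodule_socle try (S := predT)) => //.
Qed.

(** * The center as equivariant functions on [N] *)

Lemma twisted_centerP (z : A) :
  center A z <-> (forall s, s \notin N -> z s = 0) /\
                 (forall s g, z (s ^ g)%g = to (z s) g).
Proof.
(* Commuting with scalars gives [z s * y = y ^ s * z s], hence support in [N]; commuting with group
   elements gives equivariance. *)
split=> [zZ|[zN zJ] f].
  split=> [s|s g].
    case: (eqVneq (z s) 0) => // zs0 /fact_kerP[] y.
    have /ffunP/(_ s) := zZ (tw to 1%g y).
    rewrite mul_twE tw_mulE invg1 mulg1 mul1g fact_id mulrC => /esym.
    exact: (mulIf zs0).
  have /ffunP/(_ (s * g)%g) := zZ (tw to g 1).
  by rewrite mul_twE tw_mulE mulgK mulr1 fact1 mul1r conjgE.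
rewrite [f]twE; apply: commr_sum => g _; move: (f g) => y.
apply/ffunP => r; rewrite mul_twE tw_mulE -zJ conjgE.
rewrite mulgKV mulrC; have [sN|/zN->] := boolP ((g^-1 * r)%g \in N).
  by rewrite (fact_kerP _ _ sN).
by rewrite !mulr0.
Qed.

Definition class_indicator (C : {set gT}) : V := [ffun s => (s \in C)%:R].

(** The trace over [G] of [y] times the indicator of [C], where [G] acts on functions through
    conjugation and on their values. *)
Definition class_trace (C : {set gT}) (y : L) : A :=
  [ffun s => \sum_g ((s ^ g^-1)%g \in C)%:R * to y g].

Lemma classes_class (G : {group gT}) C x :
  C \in classes G -> x \in C -> C = (x ^: G)%g.
Proof. by case/imsetP=> u _ -> xu; apply/esym/class_eqP. Qed.

Lemma classes_sub (G : {group gT}) C : C \in classes G -> C \subset G.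
Proof. by case/imsetP=> u Gu ->; rewrite class_subG. Qed.

Lemma fact_ker_normal s g : ((s ^ g)%g \in N) = (s \in N).
Proof.
suff H u h : u \in N -> (u ^ h)%g \in N.
  by apply/idP/idP => [/(H _ g^-1%g)|/(H _ g)//]; rewrite conjgK.
move=> /fact_kerP uN; apply/fact_kerP => y.
by rewrite conjgE !fact_mulg uN -fact_mulg mulVg fact_id.
Qed.

Lemma class_trace_center C y :
  C \in classes N -> center A (class_trace C y).
Proof.
move=> CN; apply/twisted_centerP; split=> [s sN|s h]; rewrite !ffunE.
  rewrite big1 // => g _; rewrite [_ \in C](contraNF _ sN) ?mul0r // => sC.
  by rewrite -(fact_ker_normal s g^-1%g); apply: (subsetP (classes_sub CN)).
rewrite fact_sum [LHS](reindex_inj (mulIg h)); apply: eq_bigr => g _ /=.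
rewrite factM fact_mulg invMg conjgM conjgK; congr (_ * _).
by case: (_ \in C); rewrite ?fact1 ?Defs.fact0.
Qed.

(** [N] acts trivially on [L], so equivariance makes [z] a class function on [N]. *)
Lemma center_indicator z : center A z ->
  z = \sum_(C in classes N) z (repr C) *: (class_indicator C : V).
Proof.
case/twisted_centerP=> zN zJ; apply/ffunP=> s; rewrite sum_ffunE.
have [sN|sN] := boolP (s \in N); last first.
  rewrite zN // big1 // => C /classes_sub/subsetP CN.
  by rewrite !ffunE [s \in C](contraNF (CN s) sN) scaler0.
rewrite (bigD1 (s ^: N)%g) ?mem_classes //= big1 => [|C /andP[CN]]; last first.
  rewrite !ffunE; have [sC|_ _] := boolP (s \in C); last by rewrite scaler0.
  by rewrite -(classes_class CN sC) eqxx.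
rewrite addr0 !ffunE class_refl; have [g gN ->] := repr_class [group of N] s.
by rewrite -[RHS]/(z _ * 1) mulr1 zJ (fact_kerP _ _ gN).
Qed.

Hypothesis hn : (#|N|%:R : L) != 0.

(** After exchanging the sums, the Galois coordinates leave only the terms with [g] in [N]; each is
    the indicator at [s], as [C] is stable under [N]. *)
Lemma indicator_trace (r : seq (L * L)) C : C \in classes N ->
  (forall s, \sum_(p <- r) p.1 * to p.2 s = (s \in N)%:R) ->
  class_indicator C =
    \sum_(p <- r) (#|N|%:R^-1 * p.1) *: (class_trace C p.2 : V).
Proof.
move=> CN rE; apply/ffunP=> s; rewrite sum_ffunE !ffunE.
under eq_bigr => p _ do
  rewrite !ffunE -[_ *: _]/(_ * _) -mulrA mulr_sumr.
rewrite -mulr_sumr exchange_big /=.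
under eq_bigr => g _.
  under eq_bigr do rewrite mulrCA.
  rewrite -mulr_sumr rE.
  over.
rewrite (bigID (mem N)) /= [X in _ + X]big1 => [|g /negPf->]; last first.
  by rewrite mulr0.
rewrite addr0 (eq_bigr (fun=> (s \in C)%:R)) => [|g gN].
  by rewrite sumr_const -[X in _ * X]mulr_natl mulKf.
rewrite gN mulr1; case/imsetP: CN => u _ ->.
by rewrite memJ_norm // (subsetP (class_norm u N)) // groupVr.
Qed.

Lemma free_class_indicators :
  free [seq class_indicator C | C <- enum (classes N)].
Proof.
set e := enum (classes N); set X := [seq _ | _ <- e].
have ltX (i : 'I_(size X)) : (i < size e)%N.
  by rewrite -(size_map class_indicator).
have eN (i : 'I_(size X)) : nth set0 e i \in classes N.
  by rewrite -mem_enum mem_nth.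
apply/(freeP (X := in_tuple X)) => k k0 j; pose s := repr (nth set0 e j).
have sj : s \in nth set0 e j.
  by rewrite /s; case/imsetP: (eN j) => u _ ->; apply: (mem_repr u); apply: class_refl.
move/ffunP/(_ s): k0; rewrite sum_ffunE (bigD1 j) //= big1 => [|i ij].
  rewrite addr0 (nth_map set0) //.
  by rewrite !ffunE sj -[_ *: _]/(_ * _) mulr1.
rewrite (nth_map set0) // !ffunE.
have [si|_] := boolP (s \in _); last by rewrite scaler0.
case/eqP: ij; apply/val_inj/eqP.
rewrite -(nth_uniq set0 (ltX i) (ltX j) (enum_uniq _)).
by rewrite (classes_class (eN i) si) (classes_class (eN j) sj).
Qed.

(** Indicators and class traces have the same [L]-span: indicators are combinations of traces, and
    traces are central, hence combinations of indicators. The basis is chosen among the traces and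
    counted by the indicators. *)
Lemma center_basis : exists bs : seq V,
  [/\ free bs, forall b, b \in bs -> center A b, size bs = #|classes N| &
      forall z, center A z -> z \in <<bs>>%VS].
Proof.
have [r rE] := galois_coordinates to.
pose ys := [seq class_trace C p.2 : V | C <- enum (classes N), p <- r].
have ysZ (b : V) : b \in ys -> center A b.
  case/allpairsP=> -[C p] /= [CN _ ->]; apply: class_trace_center.
  by rewrite mem_enum in CN.
have [bs [bs_free bsZ bsE]] := free_subset_span ysZ.
pose X := [seq class_indicator C | C <- enum (classes N)].
have centerX z : center A z -> z \in <<X>>%VS.
  move/center_indicator=> ->; apply: memv_suml => C CN; apply/memvZ/memv_span.
  by apply: map_f; rewrite mem_enum.
have XE : <<X>>%VS = <<ys>>%VS.
  apply/eqP; rewrite eqEsubv; apply/andP; split; apply/span_subvP => b.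
    case/mapP=> C; rewrite mem_enum => CN ->.
    rewrite (indicator_trace CN rE) big_seq; apply: memv_suml => p pr.
    by apply/memvZ/memv_span/allpairs_f; rewrite ?mem_enum.
  by move/ysZ/centerX.
exists bs; split=> // [|z]; last by rewrite bsE -XE; apply: centerX.
rewrite -(eqP bs_free) bsE -XE (eqP free_class_indicators) size_map.
by rewrite -cardE.
Qed.

Lemma has_dim_center_twisted : has_dim K (center A) #|classes N|.
Proof.
have [bs [bs_free bsZ /eqP szbs bs_span]] := center_basis.
pose b := Tuple szbs; exists (fun i => b`_i : A).
have sumK (c : 'I_#|classes N| -> K) :
    \sum_i c i *: (b`_i : A) = \sum_i val (c i) *: (b`_i : V) by [].
split=> [i|c c0 i|z zZ].
- by apply/bsZ/mem_nth; rewrite (eqP szbs).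
- apply: val_inj; rewrite /=.
  by have /freeP/(_ (fun i => val (c i)))-> : free b := bs_free.
have zE := coord_span (bs_span z zZ : z \in <<b>>%VS).
have fixc i : coord b i z \in fixed to.
  apply/fixedP => g.
  (* The expansion of [z] with its coordinates moved by [g]. As [z] and the basis are equivariant,
     [w = z], and uniqueness of coordinates shows that they are fixed. *)
  pose w : V := \sum_j to (coord b j z) g *: b`_j.
  suff wz : w = z by rewrite -{2}wz coord_sum_free.
  apply/ffunP=> s; rewrite -[s](conjgKV g).
  have [_ zJ] := (twisted_centerP z).1 zZ.
  rewrite zJ [in RHS]zE !sum_ffunE fact_sum; apply: eq_bigr => j _.
  have bj : b`_j \in bs by apply: mem_nth; rewrite (eqP szbs).
  have [_ bJ] := (twisted_centerP (b`_j)).1 (bsZ _ bj).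
  by rewrite !ffunE bJ -[RHS]/(to (_ * _) g) factM.
exists (fun i => FixedField (fixc i)); rewrite sumK.
exact: zE.
Qed.

End Twisted.

Theorem corollary1p29 (gT : finGroupType) (L : fieldType)
    (to : fieldAction gT L)
    (hn : (#|fact_ker to|%:R : fixedField to) \is a GRing.unit)
    (k : nat) (X : 'I_k -> lmodType (twisted to)^c)
    (hX : simple_representatives X) :
  exists d : 'I_k -> nat,
    [/\ forall l, has_dim (fixedField to) (center (endo (X l))) (d l),
        has_dim (fixedField to) (center (twisted to)) (\sum_l d l)%N
      & (\sum_l d l)%N = #|classes (fact_ker to)| ].
Proof.
have n0 : (#|fact_ker to|%:R : L) != 0.
  by move: hn; rewrite unitfE -(inj_eq val_inj) rmorph_nat.
have dimZ := has_dim_center_twisted n0.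
have [d [dX dE]] := has_dim_center_semisimple hX (twisted_socle n0) dimZ.
by exists d; split; rewrite ?dE.
Qed.
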